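(* For any positive integers $p,q$ with $\frac12<\frac pq<1$, there exists a (finite, simple, connected) planar graph $G$ such that $\mathrm{dep}(G)=\frac pq$.
   Context: For a connected graph $G$, $\tau(G)$ is the number of spanning trees of $G$, and for $e\in E(G)$, $\tau_G(e)$ is the number of spanning trees of $G$ containing $e$. The spanning tree edge density of $e$ is $d_G(e)=\tau_G(e)/\tau(G)$, and the spanning tree edge dependence of $G$ is $\mathrm{dep}(G)=\max_{e\in E(G)}d_G(e)$. *)

(* Defs.v *)
From HB Require Import structures.
From mathcomp Require Import all_boot all_order all_algebra.
From mathcomp Require Import all_classical all_reals all_analysis.

Set Implicit Arguments.
Unset Strict Implicit.
Unset Printing Implicit Defensive.

Import Order.TTheory GRing.Theory Num.Theory.
Import numFieldNormedType.Exports.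

Local Open Scope classical_set_scope.
Local Open Scope ring_scope.

Record sgraph := SGraph {
  vertex : finType;
  edges : {set {set vertex}};
  card_edge : forall e, e \in edges -> #|e| = 2%N
}.

Section EdgeSets.
Variables (T : finType) (F : {set {set T}}).

Definition adj : rel T := fun x y => ([set x; y] \in F)%SET.

Definition connected_on : Prop :=
  (0 < #|T|)%N /\ forall x y : T, connect adj x y.

Definition acyclic_on : Prop :=
  forall c : seq T, (2 < size c)%N -> ~ ucycle adj c.

End EdgeSets.

Definition connected_graph (G : sgraph) : Prop := connected_on (edges G).

Definition spanning_tree (G : sgraph) (F : {set {set vertex G}}) : Prop :=
  [/\ F \subset edges G, connected_on F & acyclic_on F].

Definition spanning_trees (G : sgraph) : {set {set {set vertex G}}} :=
  [set F | `[< spanning_tree F >]]%SET.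

Definition tau (G : sgraph) : nat := #|spanning_trees G|.

Definition tau_edge (G : sgraph) (e : {set vertex G}) : nat :=
  #|[set F in spanning_trees G | e \in F]%SET|.

Definition density (G : sgraph) (e : {set vertex G}) : rat :=
  (tau_edge e)%:R / (tau G)%:R.

(* Densities are nonnegative, so the unit 0 does not affect the maximum unless
   G has no edge. *)
Definition dep (G : sgraph) : rat :=
  \big[Num.max/0]_(e in edges G) density e.

(* [pos] places the vertices in the plane, and [arc e], restricted to [0, 1],
   is a simple arc joining the two ends of e.  The function [arc] is constrained
   only on the edges of G. *)
Definition plane_drawing (R : realType) (G : sgraph)
    (pos : vertex G -> R * R) (arc : {set vertex G} -> R -> R * R) : Prop :=
  [/\ injective pos,
      forall e, e \in edges G ->
        [/\ {within `[0, 1], continuous (arc e)},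
            {in `[0, 1] &, injective (arc e)} &
            [set arc e 0; arc e 1] = pos @` [set` e]],
      forall e v (t : R), e \in edges G -> t \in `]0, 1[ -> arc e t <> pos v &
      forall e f (s t : R), e \in edges G -> f \in edges G -> e != f ->
        s \in `]0, 1[ -> t \in `]0, 1[ -> arc e s <> arc f t].

Definition planar (R : realType) (G : sgraph) : Prop :=
  exists pos arc, @plane_drawing R G pos arc.

(* Main.v *)
(* Let G be a cycle made of one closing edge e and L blocks K_{2,m}, each joining
   two consecutive hubs through m middle vertices.  A block has resistance 2/m,
   so e, in parallel with a resistance r = 2L/m, has density r/(1+r).  Taking
   L = pq and m = 2(q-p)q gives r = p/(q-p), hence density p/q.
   A spanning tree contains both edges at some middle vertex in every block,
   exactly once, except that one block has no such vertex when the tree contains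
   e; every other middle vertex is a leaf.  For an edge f at a middle vertex v,
   swapping the two edges at v whenever v is a leaf shows that at most half of
   the trees in which v is a leaf contain f, and by symmetry v is not a leaf in
   at most 1/m of the trees.  So f has density at most 1/2 + 1/(2m) <= p/q. *)
Require Import Defs.
From mathcomp Require Import all_boot all_order all_algebra fingroup perm.
From mathcomp Require Import all_classical all_reals all_analysis.
From mathcomp Require Import zify ring lra.

Set Implicit Arguments.
Unset Strict Implicit.
Unset Printing Implicit Defensive.

Import Order.TTheory GRing.Theory Num.Theory.
Import numFieldNormedType.Exports.
Local Open Scope ring_scope.

(** * Connectedness and acyclicity of edge sets from rank functions *)

Section Forests.
Variables (T : finType) (F : {set {set T}}).

Lemma adjC (x y : T) : adj F x y = adj F y x.
Proof. by rewrite /adj finset.setUC. Qed.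

Lemma eq_set2 (a b c d : T) :
  ([set a; b]%SET == [set c; d]%SET) =
  ((a == c) && (b == d)) || ((a == d) && (b == c)).
Proof.
apply/eqP/idP => [E|/orP[]/andP[/eqP-> /eqP->] //]; last by rewrite finset.setUC.
have := finset.set21 a b; have := finset.set22 a b.
have := finset.set21 c d; have := finset.set22 c d.
rewrite E -{1 2}E !finset.in_set2 !(eq_sym c) !(eq_sym d).
by do 4![case: (_ == _) => //].
Qed.

(** Descending in rank, every vertex reaches [r], as only [r] may lack a lower neighbour. *)
Lemma connected_of_rank (rank : T -> nat) (r : T) :
  (forall v, v != r -> exists2 u, adj F u v & (rank u < rank v)%N) ->
  connected_on F.
Proof.
move=> down; split; first by apply/card_gt0P; exists r.
have rootP v : connect (adj F) r v.
  have [n] := ubnP (rank v); elim: n v => // n IHn v le_v.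
  have [->|/down[u uv lt_uv]] := eqVneq v r; first exact: connect0.
  apply: (connect_trans _ (connect1 uv)); apply: IHn.
  exact: leq_trans lt_uv _.
have symF : connect_sym (adj F) by apply: sym_connect_sym => x y; exact: adjC.
by move=> x y; apply: (connect_trans (y := r)) => //; rewrite symF.
Qed.

(* A vertex of maximal rank on a cycle would have two neighbours of rank at
   most its own. *)
Lemma acyclic_of_rank (rank : T -> nat) :
  (forall u v w, adj F u v -> adj F w v ->
     (rank u <= rank v)%N -> (rank w <= rank v)%N -> u = w) ->
  acyclic_on F.
Proof.
move=> uniq_down c sz_c /andP[cyc_c uniq_c].
have [x0 x0c] : exists x0, x0 \in c.
  by case: c sz_c {cyc_c uniq_c} => // x c _; exists x; rewrite mem_head.
case: (arg_maxnP rank x0c) => v vc max_v.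
have [i c' def_c] := rot_to vc.
have mem_c u : u \in v :: c' -> u \in c by rewrite -def_c mem_rot.
move: cyc_c uniq_c sz_c; rewrite -(rot_cycle i) -(rot_uniq i) -(size_rot i) def_c.
case: c' def_c mem_c => [//|a c1] _ mem_c; case/lastP: c1 mem_c => [//|c1 z] mem_c.
rewrite /= rcons_path last_rcons => /and3P[va _ zv] /andP[_ /andP[+ _]] _.
suff -> : a = z by rewrite mem_rcons mem_head.
apply: (uniq_down a v z) => //; first by rewrite adjC.
  by apply/max_v/mem_c; rewrite !inE eqxx orbT.
by apply/max_v/mem_c; rewrite !(inE, mem_rcons) eqxx !orbT.
Qed.

(** A simple path from [x] to [y] avoiding their edge would close up with it to a cycle. *)
Lemma acyclic_bridge (x y : T) : acyclic_on F -> adj F x y -> x != y ->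
  ~ connect (adj (F :\ [set x; y])%SET) x y.
Proof.
move=> acF xy neq_xy /connectP[p0 p0P].
case/shortenP: p0P => p pP uniq_p _ def_y.
apply: (acF (x :: p)).
  (* The cycle has at least three vertices: a one-step path would be the deleted edge itself. *)
  case: p pP def_y {uniq_p} => [|a [|b p]] //=; first by move=> _ E; rewrite E eqxx in neq_xy.
  by move=> /andP[+ _] E; rewrite -E /adj finset.setD11.
apply/andP; split=> //=; rewrite rcons_path -def_y adjC xy andbT.
by apply: sub_path pP => u v; rewrite /adj finset.in_setD1 => /andP[].
Qed.

End Forests.

(** * Counting functions with one distinguished value *)

Section OneMarked.
Variables (I : finType) (T : finType).
Implicit Types (P Q : pred T) (f : {ffun I -> T}).

(** The pattern occurs at two levels: the double middle vertex of a block, and the open block of a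
    tree. *)
Definition one_marked P Q : pred {ffun I -> T} :=
  fun f => [exists i, P (f i) && [forall k, (k != i) ==> Q (f k)]].

Lemma one_markedP P Q f :
  reflect (exists2 i, P (f i) & forall k, k != i -> Q (f k)) (one_marked P Q f).
Proof.
apply: (iffP existsP) => [[i /andP[Pi /forall_inP Qi]]|[i Pi Qi]]; exists i => //.
by rewrite Pi; apply/forall_inP.
Qed.

(** As [P] excludes [Q], the marked index is unique, so the functions split into [#|I|] disjoint
    product families. *)
Lemma card_one_marked P Q : (forall x, P x -> ~~ Q x) ->
  #|one_marked P Q| = (#|I| * #|P| * #|Q| ^ #|I|.-1)%N.
Proof.
move=> PQ.
pose fam (i : I) := family (fun k => if k == i then P else Q : pred T).
have famP i f : reflect (P (f i) /\ forall k, k != i -> Q (f k)) (f \in fam i).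
  apply: (iffP familyP) => [H|[Pi Qi] k].
    by split=> [|k ki]; [have := H i; rewrite eqxx | have := H k; rewrite (negbTE ki)].
  by case: eqVneq => [->//|ki]; exact: Qi.
transitivity (\sum_i #|fam i|)%N.
  rewrite -sum1_card big_mkcond /=.
  under [RHS]eq_bigr do rewrite -sum1_card big_mkcond /=.
  rewrite exchange_big /=; apply: eq_bigr => f _.
  case: ifPn => [/one_markedP[i Pi Qi]|nf].
    rewrite (bigD1 i) //= ifT; last exact/famP.
    rewrite big1 // => k ki; case: ifP => // /famP[Pk _].
    by have := PQ _ Pk; rewrite Qi.
  rewrite big1 // => i _; case: ifP => // /famP[Pi Qi].
  by case/one_markedP: nf; exists i.
rewrite (eq_bigr (fun=> (#|P| * #|Q| ^ #|I|.-1)%N)) => [|i _].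
  by rewrite sum_nat_const mulnA.
rewrite /fam card_family foldrE big_map big_enum /= (bigD1 i) //= eqxx; congr (_ * _)%N.
rewrite (eq_bigr (fun=> #|Q|)) => [|k /negbTE-> //].
by rewrite prod_nat_const cardC1.
Qed.

End OneMarked.

(** * The graph, and configurations that encode spanning trees *)

Section Chain.
Variables n m : nat.
Local Notation L := n.+1.

Definition vtx : finType := ('I_L.+1 + 'I_L * 'I_m)%type.
Definition edge_index : finType := option ('I_L * 'I_m * bool).

Implicit Types (x : edge_index) (u v : vtx).

Definition hub (k : nat) : vtx := inl (inord k).

(* [Some (i, j, s)] joins the [j]-th middle vertex of block [i] to hub [i] or
   hub [i.+1] according to [s]; [None] is the closing edge. *)
Definition ends x : vtx * vtx :=
  match x with
  | None => (inl ord0, inl ord_max)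
  | Some (i, j, s) => (hub (i + s), inr (i, j))
  end.

Definition edge x : {set vtx} := [set (ends x).1; (ends x).2]%SET.

Lemma side_le (i : 'I_L) (s : bool) : (i + s <= L)%N.
Proof. by have := ltn_ord i; case: s; lia. Qed.

Lemma hubE (k : nat) (l : 'I_L.+1) : (k <= L)%N -> (hub k == inl l) = (k == l).
Proof.
move=> le_k; apply/eqP/eqP => [[/(congr1 val)]|->]; first by rewrite /= inordK.
by rewrite /hub inord_val.
Qed.

Lemma edge_inj : injective edge.
Proof.
move=> x y /eqP; rewrite eq_set2.
case: x y => [[[i j] s]|] [[[i' j'] s']|] // /orP[]/andP[] //.
move=> E /eqP[ei ej]; move: E; rewrite -ei -ej hubE ?side_le //.
by rewrite inordK ?ltnS ?side_le // eqn_add2l; case: s s' => [] [].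
Qed.

Lemma card_edge_chain e : e \in [set edge x | x in setT]%SET -> #|e| = 2%N.
Proof. by case/imsetP => [[[[i j] s]|]] _ ->; rewrite cards2. Qed.

Definition chain : sgraph := SGraph card_edge_chain.

(* [None] stands for both edges at a middle vertex and [Some s] for the edge on
   side [s] only; the boolean of a configuration tells whether the closing edge
   is present. *)
Definition block : finType := {ffun 'I_m -> option bool}.
Definition config : finType := ({ffun 'I_L -> block} * bool)%type.

Implicit Types c : config.

Definition present c : pred edge_index := fun x =>
  match x with
  | None => c.2
  | Some (i, j, s) => c.1 i j != Some (~~ s)
  end.

Definition subgraph c : {set {set vtx}} := [set edge x | x in present c]%SET.

(** Without a double vertex a block does not link its two hubs; with exactly one it links them by a
    single path. *)
Definition open_block : pred block := fun h => [forall j, h j != None].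
Definition closed_block : pred block := one_marked (pred1 None) (predC1 None).

(** A tree breaks the cycle of blocks exactly once: at an open block if the closing edge is present,
    at the closing edge otherwise. *)
Definition tree_code : pred config := fun c =>
  if c.2 then one_marked open_block closed_block c.1
  else [forall i, closed_block (c.1 i)].

Lemma mem_subgraph c x : (edge x \in subgraph c) = present c x.
Proof. by rewrite mem_imset //; exact: edge_inj. Qed.

Lemma subgraph_inj : injective subgraph.
Proof.
move=> c c' E; have P x : present c x = present c' x by rewrite -!mem_subgraph E.
case: c c' P {E} => [g b] [g' b'] P; have /= -> := P None; congr (_, _).
apply/ffunP => i; apply/ffunP => j.
have /= := P (Some (i, j, true)); have /= := P (Some (i, j, false)).
by case: (g i j) (g' i j) => [[]|] [[]|].
Qed.

Definition hub_mid c (k : nat) (i : 'I_L) (j : 'I_m) : bool :=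
  (k == i) && (c.1 i j != Some true) || (k == i.+1) && (c.1 i j != Some false).

Definition code_adj c u v : bool :=
  match u, v with
  | inl k, inl l => c.2 && ((k == 0%N :> nat) && (l == L :> nat) ||
                            (k == L :> nat) && (l == 0%N :> nat))
  | inl k, inr (i, j) | inr (i, j), inl k => hub_mid c k i j
  | inr _, inr _ => false
  end.

Lemma adj_subgraph c u v : adj (subgraph c) u v = code_adj c u v.
Proof.
have adjP x : ([set u; v]%SET == edge x) = _ := eq_set2 _ _ _ _.
apply/imsetP/idP => [[x xc /eqP]|].
  rewrite adjP; case: x xc {adjP} => [[[i j] s]|] /=; rewrite /in_mem /= => xc; last first.
    by case/orP=> /andP[/eqP-> /eqP->]; rewrite /= xc !eqxx ?orbT.
  have h : hub_mid c (inord (i + s) : 'I_L.+1) i j.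
    rewrite /hub_mid inordK; last by have := ltn_ord i; case: (s) => /=; lia.
    by case: s xc => /= -> /=; rewrite ?addn1 ?addn0 eqxx ?orbT.
  by case/orP=> /andP[/eqP-> /eqP->].
have midP k i j : hub_mid c k i j ->
    exists2 s : bool, k = (i + s)%N & c.1 i j != Some (~~ s).
  by case/orP=> /andP[/eqP-> ?]; [exists false|exists true]; rewrite ?addn0 ?addn1.
case: u v adjP => [k|[i j]] [l|[i' j']] //= adjP.
- case/andP=> c2 H; exists None => //; apply/eqP; rewrite adjP /=.
  by rewrite /eq_op /= -!val_eqE /=; case/orP: H => /andP[-> ->]; rewrite ?orbT.
- case/midP=> s ks cs; exists (Some (i', j', s)) => //; apply/eqP; rewrite adjP /=.
  by rewrite !(eq_sym (inl k)) hubE ?side_le // ks !eqxx.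
- case/midP=> s ks cs; exists (Some (i, j, s)) => //; apply/eqP; rewrite adjP /=.
  by rewrite !(eq_sym (inl l)) hubE ?side_le // ks !eqxx /= ?orbT.
Qed.

(** Numbering the gap by [i0], with [L] for the closing edge, merges the two cases. *)
Lemma tree_codeP c : reflect
  (exists2 i0 : nat, (i0 <= L)%N /\ c.2 = (i0 < L)%N &
     forall i : 'I_L, if i == i0 :> nat then open_block (c.1 i) else closed_block (c.1 i))
  (tree_code c).
Proof.
rewrite /tree_code; case: c => g [] /=.
  apply: (iffP (one_markedP _ _ _)) => [[i Oi Ci]|[i0 [_ lt_i0] H]].
    exists i; first by rewrite ltnW //; split=> //; apply/esym/ltn_ord.
    by move=> k; case: ifPn => [/eqP/val_inj->//|/Ci].
  have {}lt_i0 := esym lt_i0; exists (Ordinal lt_i0).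
    by have := H (Ordinal lt_i0); rewrite eqxx.
  by move=> k /negbTE ki; have := H k; rewrite -val_eqE /= in ki *; rewrite ki.
apply: (iffP forallP) => [C|[i0 [le_i0 lt_i0] H] i].
  by exists L => [|i]; rewrite ?ltnn // ifN // neq_ltn ltn_ord.
have := H i; rewrite ifN //; apply/eqP; have := ltn_ord i; lia.
Qed.

Lemma tree_code_tree c : tree_code c -> @spanning_tree chain (subgraph c).
Proof.
case/tree_codeP=> i0 [le_i0 c2] blockP.
(* Ranks increase around the cycle, starting just after the gap [i0], where
   [i0 = L] means that the gap is the missing closing edge. *)
pose hrank k := (if i0 < k then (k - i0.+1).*2 else (k + L - i0).*2)%N.
(* Doubling the hub ranks leaves an odd value for the double vertex between two hubs. Leaves lie
   above all hubs, whose ranks are at most [2 L]. *)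
pose rank v : nat := match v with
  | inl k => hrank k
  | inr (i, j) => if c.1 i j == None then (hrank i).+1 else (L.*2).+3
  end.
have noneP (i : 'I_L) j : c.1 i j = None -> i != i0 :> nat.
  move=> E; apply/eqP => ii0; have := blockP i; rewrite ii0 eqxx.
  by move=> /forallP/(_ j); rewrite E.
have none_uniq (i : 'I_L) j j' : c.1 i j = None -> c.1 i j' = None -> j = j'.
  move=> E E'; have := blockP i; rewrite (negbTE (noneP _ _ E)).
  case/one_markedP => k _ Q; apply/eqP.
  have [->|/Q] := eqVneq j k; last by rewrite /= E.
  by have [//|/Q] := eqVneq j' k; rewrite /= E'.
have some_none (i : 'I_L) : i != i0 :> nat -> exists j, c.1 i j = None.
  by move=> /negbTE ii0; have := blockP i; rewrite ii0 => /one_markedP[j /eqP]; exists j.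
have hrank_le k : (k <= L)%N -> (hrank k <= L.*2)%N.
  by rewrite /hrank; case: ifP; lia.
have hrankS (i : 'I_L) : i != i0 :> nat -> hrank i.+1 = (hrank i).+2.
  by rewrite /hrank; case: ifP; case: ifP; lia.
split.
- by apply/fintype.subsetP => e /imsetP[x _ ->]; apply: imset_f; rewrite inE.
(* The root is the hub just after the gap, of rank 0. *)
- apply: (connected_of_rank (rank := rank) (r := hub (if i0 < L then i0.+1 else 0)%N)).
  case=> [k|[i j]]; rewrite eq_sym.
    rewrite hubE => [kr|]; last by case: ifP.
    (* Hub 0 descends along the closing edge, any other hub through the double vertex of the
       preceding block. *)
    have [k0|k_gt0] := posnP k.
      have lt_i0 : (i0 < L)%N by move: kr; rewrite k0; case: ifP => //; rewrite eqxx.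
      exists (inl ord_max); rewrite ?adj_subgraph /= ?c2 ?lt_i0 ?k0 ?eqxx ?orbT //.
      by rewrite /hrank lt_i0 /=; lia.
    have lt_k1 : (k.-1 < L)%N by have := ltn_ord k; lia.
    have k1_i0 : Ordinal lt_k1 != i0 :> nat by move: kr => /=; case: ifP; lia.
    have [j cj] := some_none _ k1_i0; have /= := hrankS _ k1_i0; rewrite prednK // => rk.
    exists (inr (Ordinal lt_k1, j)).
      by rewrite adj_subgraph /= /hub_mid /= cj /= prednK // eqxx orbT.
    by rewrite /= cj /= rk.
  move=> _; case cij: (c.1 i j) => [s|]; last first.
    have inord_i : @inord L i = i :> nat by rewrite inordK // ltnS ltnW.
    by exists (hub i); rewrite ?adj_subgraph /= ?/hub_mid cij inord_i ?eqxx.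
  exists (hub (i + s)).
    rewrite adj_subgraph /= /hub_mid cij inordK ?ltnS ?side_le //.
    by case: (s); rewrite ?addn0 ?addn1 eqxx ?orbT.
  rewrite /= cij inordK ?ltnS ?side_le //.
  by have := hrank_le _ (side_le i s); lia.
(* The only possible lower neighbour is hub [L] for hub 0, the double vertex of the preceding block
   for another hub, and a single hub for a middle vertex. *)
apply: (acyclic_of_rank (rank := rank)) => u v w; rewrite !adj_subgraph.
have hub_hub (k l : 'I_L.+1) : code_adj c (inl k) (inl l) -> (hrank k <= hrank l)%N ->
    k = ord_max /\ l = 0%N :> nat.
  case/andP; rewrite c2 => lt_i0 /orP[]/andP[/eqP k0 /eqP l0].
    by rewrite k0 l0 /hrank lt_i0 /=; lia.
  by move=> _; split=> //; apply: val_inj.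
have mid_hub i j (l : 'I_L.+1) : hub_mid c l i j -> (rank (inr (i, j)) <= hrank l)%N ->
    c.1 i j = None /\ l = i.+1 :> nat.
  rewrite /=; case: eqP => [cij|_] H le_r; last by have := hrank_le l (ltn_ord l); lia.
  split=> //; move: H; rewrite /hub_mid cij !andbT => /orP[]/eqP // li.
  by move: le_r; rewrite li ltnn.
case: v => [l|[i j]].
  case: u w => [k|[i j]] [k'|[i' j']] //.
  - move=> a a' /(hub_hub _ _ a)[-> _] /(hub_hub _ _ a')[-> _] //.
  - by move=> a a' /(hub_hub _ _ a)[_ l0] /(mid_hub _ _ _ a')[_]; rewrite l0.
  - by move=> a a' /(mid_hub _ _ _ a)[_ +] /(hub_hub _ _ a')[_ l0]; rewrite l0.
  - move=> a a' /(mid_hub _ _ _ a)[ci li] /(mid_hub _ _ _ a')[ci' li'].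
    have ii' : i = i' by apply: val_inj => /=; lia.
    by rewrite -ii' in ci' *; rewrite (none_uniq _ _ _ ci ci').
case: u w => [k|[i' j']] [k'|[i'' j'']] //=; rewrite /hub_mid.
case cij: (c.1 i j) => [s|] /=.
  move=> H H' _ _; congr inl; apply: val_inj => /=; case: s H H' {cij}; rewrite !(andbT, andbF, orbF) /=; lia.
have := hrankS _ (noneP _ _ cij) => rk; rewrite !andbT => H H' le_k le_k'.
congr inl; apply: val_inj => /=.
case/orP: H => /eqP E; last by move: le_k; rewrite E rk; lia.
case/orP: H' => /eqP E'; last by move: le_k'; rewrite E' rk; lia.
by rewrite E.
Qed.

End Chain.

(** * Every spanning tree comes from a tree code *)

Section Chain.
Variables n m : nat.
Local Notation L := n.+1.
Implicit Types (x : edge_index n m) (u v : vtx n m) (c : config n m).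

(** Two double vertices in one block would form a 4-cycle with its two hubs. *)
Lemma blockP c (i : 'I_L) : acyclic_on (subgraph c) ->
  ~~ open_block (c.1 i) -> closed_block (c.1 i).
Proof.
move=> acF /forallPn[j]; rewrite negbK => /eqP cij.
apply/one_markedP; exists j => [|k kj]; first by rewrite /= cij.
apply/eqP => cik.
case: (acF [:: hub n m i; inr (i, j); hub n m i.+1; inr (i, k)]) => //.
apply/andP; split; last first.
  have neq_hub : hub n m i != hub n m i.+1.
    by rewrite hubE ?(ltnW (ltn_ord i)) // inordK //; have := ltn_ord i; lia.
  have neq_mid : inr (i, j) != inr (i, k) :> vtx n m.
    by apply: contra kj => /eqP[->].
  by rewrite /= !inE !negb_or neq_hub neq_mid.
have inord_i : @inord L i = i :> nat by rewrite inordK // ltnS ltnW.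
have inord_i1 : @inord L i.+1 = i.+1 :> nat by rewrite inordK // ltnS.
by rewrite /= !adj_subgraph /= /hub_mid cij cik inord_i inord_i1 !eqxx !orbT.
Qed.

(** Two gaps would disconnect the graph; [i2 = L] covers the case where the second gap is the
    missing closing edge. *)
Lemma open_uniq c (i1 i2 : nat) : connected_on (subgraph c) ->
  (i1 < i2 <= L)%N -> (i2 = L -> ~~ c.2) ->
  (forall i : 'I_L, (i == i1 :> nat) || (i == i2 :> nat) -> open_block (c.1 i)) -> False.
Proof.
move=> [_ conF] /andP[lt_i12 le_i2] c2 openi.
(* No edge leaves the part of the cycle between the two gaps. *)
pose S : pred (vtx n m) := fun v => match v with
  | inl k => i1 < k <= i2
  | inr (i, j) => i1 < i + (c.1 i j == Some true) <= i2
  end%N.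
(* [S] counts a leaf with the hub it hangs from and a double vertex with hub [i]. A double vertex
   has both hubs on the same side, since its block is neither gap. *)
have midS (k : 'I_L.+1) i j : hub_mid c k i j -> S (inl k) = S (inr (i, j)).
  case/orP => /= /andP[/eqP->]; first by move=> /negbTE->; rewrite addn0.
  case cij: (c.1 i j) => [[]|] //= _; first by rewrite addn1.
  have : ~~ ((i == i1 :> nat) || (i == i2 :> nat)).
    by apply/negP => /openi/forallP/(_ j); rewrite cij.
  by rewrite negb_or => /andP[/eqP ? /eqP ?]; apply/idP/idP; lia.
have closedS : fingraph.closed (adj (subgraph c)) S.
  move=> u v; rewrite adj_subgraph; rewrite /in_mem /=.
  case: u v => [k|[i j]] [l|[i' j']] //; last 2 first.
  - exact: midS.
  - by move/midS.
  rewrite /= => /andP[c2T]; have ? : i2 <> L by move=> /c2; rewrite c2T.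
  by case/orP=> /andP[/eqP-> /eqP->]; apply/idP/idP; lia.
have := closed_connect closedS (conF (hub n m 0) (hub n m i2)).
by rewrite /in_mem /= !inordK //=; lia.
Qed.

(** Otherwise the paths through the closed blocks would join the ends of the closing edge, which is
    a bridge. *)
Lemma open_exists c : acyclic_on (subgraph c) -> c.2 ->
  exists i, open_block (c.1 i).
Proof.
move=> acF c2; apply/existsP; apply: contraT => /existsPn nopen.
case: (@acyclic_bridge _ _ (hub n m 0) (hub n m L) acF).
- by rewrite adj_subgraph /= c2 !inordK // !eqxx.
- by rewrite hubE // inordK.
set F := (_ :\ _)%SET.
have adjF k i j : hub_mid c k i j -> (k <= L)%N -> adj F (hub n m k) (inr (i, j)).
  move=> H le_k; rewrite /adj /F finset.in_setD1 eq_set2 /= !andbF /=.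
  by rewrite -[_ \in _]/(adj _ _ _) adj_subgraph /= inordK.
suff: forall k, (k <= L)%N -> connect (adj F) (hub n m 0) (hub n m k) by apply.
elim=> [|k IHk] lt_k; first exact: connect0.
apply: connect_trans (IHk (ltnW lt_k)) _.
have /one_markedP[j /eqP cij _] := blockP acF (nopen (Ordinal lt_k)).
apply: (connect_trans (y := inr (Ordinal lt_k, j))); apply: connect1.
  by apply: adjF (ltnW lt_k); rewrite /hub_mid cij eqxx.
by rewrite adjC; apply: adjF => //; rewrite /hub_mid cij eqxx orbT.
Qed.

Lemma tree_tree_code c : @spanning_tree (chain n m) (subgraph c) -> tree_code c.
Proof.
move=> [_ conF acF]; rewrite /tree_code; case c2: c.2; last first.
  apply/forallP => i; apply: blockP acF _; apply/negP => openi.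
  (* The missing closing edge is already a gap, so an open block would be a second one. *)
  apply: (open_uniq conF (i1 := i) (i2 := L)).
  - by rewrite ltn_ord leqnn.
  - by rewrite c2.
  - move=> k /orP[/eqP/val_inj->//|/eqP E]; have := ltn_ord k; lia.
have [i openi] := open_exists acF c2.
apply/one_markedP; exists i => // k ki; apply: blockP acF _; apply/negP => openk.
wlog lt_ik : i k openi openk ki / (i < k)%N.
  move=> W; have [|ki'|/val_inj E] := ltngtP i k; first exact: W.
    by apply: (W k i) => //; rewrite eq_sym.
  by rewrite E eqxx in ki.
apply: (open_uniq conF (i1 := i) (i2 := k)).
- by rewrite lt_ik ltnW.
- by move=> E; have := ltn_ord k; lia.
- by move=> l /orP[]/eqP/val_inj->.
Qed.

(** Configurations cannot express a middle vertex without edges, but connectedness rules that state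
    out. *)
Lemma tree_subgraph (F : {set {set vtx n m}}) :
  @spanning_tree (chain n m) F -> exists c, F = subgraph c.
Proof.
case=> subF [_ conF] _.
pose c : config n m := ([ffun i => [ffun j =>
  if edge (Some (i, j, true)) \notin F then Some false
  else if edge (Some (i, j, false)) \notin F then Some true else None]],
  edge None \in F).
(* An isolated middle vertex would be a closed set missing hub 0. *)
have mid_edge i j : exists s, edge (Some (i, j, s)) \in F.
  apply/existsP; apply: contraT => /existsPn nF.
  have closedS : fingraph.closed (adj F) (pred1 (inr (i, j) : vtx n m)).
    move=> u v uv; rewrite /in_mem /=.
    have /imsetP[x _ E] := fintype.subsetP subF _ uv.
    have /eqP := E; rewrite eq_set2.
    case: x E => [[[i' j'] s]|] E /=; last by case/orP=> /andP[/eqP-> /eqP->].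
    have : edge (Some (i', j', s)) \in F by rewrite -E.
    have [[-> ->]|ne] := eqVneq (i', j') (i, j); first by rewrite (negbTE (nF s)).
    by move=> _ /orP[]/andP[/eqP-> /eqP->]; rewrite /eq_op /= -/(eq_op _ _) (negbTE ne).
  have := closed_connect closedS (conF (hub n m 0) (inr (i, j))).
  by rewrite /in_mem /= eqxx.
exists c; apply/setP => e; apply/idP/idP => [eF|/imsetP[x + ->]].
  have /imsetP[x _ def_e] := fintype.subsetP subF _ eF.
  rewrite def_e mem_subgraph; rewrite def_e in eF.
  case: x eF {def_e} => [[[i j] []]|] //= eF; rewrite !ffunE eF //=.
    by case: ifP.
  by case: ifP.
rewrite /in_mem /=; case: x => [[[i j] s]|] //=; rewrite !ffunE.
have [[] H] := mid_edge i j; rewrite ?H /=.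
  by case: ifPn; case: s => //; rewrite negbK.
by case: ifPn; case: s => //; rewrite negbK.
Qed.

Lemma spanning_trees_chain :
  spanning_trees (chain n m) = [set subgraph c | c in tree_code (n := n) (m := m)]%SET.
Proof.
apply/setP => F; rewrite inE; apply/asboolP/imsetP => [FT|[c cT ->]].
  by have [c Fc] := tree_subgraph FT; exists c => //; apply: tree_tree_code; rewrite -Fc.
exact: tree_code_tree.
Qed.

Lemma tau_chain : tau (chain n m) = #|tree_code (n := n) (m := m)|.
Proof. by rewrite /tau spanning_trees_chain card_imset //; exact: subgraph_inj. Qed.

Lemma tau_edge_chain x :
  @tau_edge (chain n m) (edge x) = #|[pred c : config n m | tree_code c && present c x]|.
Proof.
rewrite -(card_imset _ (@subgraph_inj n m)); apply: eq_card => F.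
rewrite spanning_trees_chain !inE; apply/andP/imsetP => [[/imsetP[c cT ->]]|[c]].
  by rewrite mem_subgraph => cx; exists c => //; rewrite inE cx andbT.
rewrite inE => /andP[cT cx] ->; rewrite mem_subgraph; split=> //.
exact: imset_f.
Qed.

End Chain.

(** * Counting tree codes and comparing them by block symmetries *)

Section Counting.
Variables n m : nat.
Local Notation L := n.+1.
Implicit Types (c : config n m) (h : block m).

(** Choose the double vertex, then a side for each of the others. *)
Lemma card_closed_block : #|closed_block (m := m)| = (m * 2 ^ m.-1)%N.
Proof.
rewrite card_one_marked ?card_ord => [|o /eqP-> //].
by rewrite card1 muln1 cardC1 card_option card_bool.
Qed.

Lemma card_open_block : #|open_block (m := m)| = (2 ^ m)%N.
Proof.
rewrite -[RHS]/(2 ^ m)%N; have <- : #|[pred o : option bool | o != None]| = 2%N.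
  by rewrite -[RHS](card_bool) -[#|[pred o | _]|]/(#|predC1 None|) cardC1 card_option card_bool.
rewrite -[X in (_ ^ X)%N]card_ord -card_ffun_on; apply: eq_card => h.
by apply/forallP/ffun_onP.
Qed.

(** Choose the open block and a side at each of its middle vertices; the other [n] blocks are
    closed. *)
Lemma card_tree_with :
  #|[pred c : config n m | tree_code c && c.2]| = (L * 2 ^ m * (m * 2 ^ m.-1) ^ n)%N.
Proof.
have inj : injective (fun g : {ffun 'I_L -> block m} => (g, true)) by move=> g g' [].
rewrite -card_open_block -card_closed_block -[X in (X * _ * _)%N]card_ord.
rewrite -[n in (_ ^ n)%N]/(L.-1) -[in (_ ^ L.-1)%N](card_ord L) -card_one_marked.
  rewrite -(fintype.card_image inj); apply: eq_card => -[g b].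
  rewrite !inE /tree_code /=; apply/idP/fintype.imageP => [|[g' Tg' [-> ->]]]; last by rewrite andbT.
  by case: b => /andP[Tg //] _; exists g.
move=> h /forallP oh; apply/negP => /one_markedP[j /eqP hj _].
by have := oh j; rewrite hj.
Qed.

Lemma card_tree_without :
  #|[pred c : config n m | tree_code c && ~~ c.2]| = ((m * 2 ^ m.-1) ^ L)%N.
Proof.
have inj : injective (fun g : {ffun 'I_L -> block m} => (g, false)) by move=> g g' [].
rewrite -card_closed_block -[X in (_ ^ X)%N]card_ord -card_ffun_on -(fintype.card_image inj).
apply: eq_card => -[g b]; rewrite !inE /tree_code /=.
apply/idP/fintype.imageP => [|[g' /ffun_onP Tg' [-> ->]]]; last by rewrite andbT; apply/forallP.
by case: b => [/andP[]//|/andP[/forallP Tg _]]; exists g => //; apply/ffun_onP.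
Qed.

Lemma card_tree : #|tree_code (n := n) (m := m)| =
  (#|[pred c : config n m | tree_code c && c.2]| +
   #|[pred c : config n m | tree_code c && ~~ c.2]|)%N.
Proof.
rewrite -(cardID [pred c : config n m | c.2]); congr (_ + _)%N.
by apply: eq_card => c; rewrite !inE andbC.
Qed.

(** Applying [psi] to block [i] alone maps tree codes injectively to tree codes. *)
Lemma leq_card_tree_block (i : 'I_L) (psi : block m -> block m) (P Q : pred (block m)) :
  injective psi ->
  (forall h, open_block h -> open_block (psi h)) ->
  (forall h, closed_block h -> closed_block (psi h)) ->
  (forall h, P h -> Q (psi h)) ->
  (#|[pred c : config n m | tree_code c && P (c.1 i)]| <=
   #|[pred c : config n m | tree_code c && Q (c.1 i)]|)%N.
Proof.
move=> psi_inj psi_open psi_closed PQ.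
pose f c : config n m := ([ffun k => if k == i then psi (c.1 k) else c.1 k], c.2).
have f_inj : injective f.
  move=> [g b] [g' b'] [/ffunP E ->]; congr (_, _); apply/ffunP => k.
  by have := E k; rewrite !ffunE /=; case: ifP => // _ /psi_inj.
rewrite -(fintype.card_image f_inj); apply/subset_leq_card/fintype.subsetP => _ /fintype.imageP[c + ->].
rewrite !inE => /andP[Tc Pc]; rewrite /= ffunE eqxx PQ // andbT.
have openf k : open_block (c.1 k) -> open_block ((f c).1 k).
  by rewrite ffunE; case: ifP => // _; exact: psi_open.
have closedf k : closed_block (c.1 k) -> closed_block ((f c).1 k).
  by rewrite ffunE; case: ifP => // _; exact: psi_closed.
move: Tc; rewrite /tree_code [(f c).2]/=; case: ifP => _.
  case/one_markedP=> k ok ck; apply/one_markedP; exists k; first exact: openf.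
  by move=> l /ck; exact: closedf.
by move=> /forallP ck; apply/forallP => k; apply: closedf.
Qed.

(** Openness and closedness depend only on the positions of the double vertices, up to
    permutation. *)
Lemma open_block_perm (s : {perm 'I_m}) h h' :
  (forall k, (h' k == None) = (h (s k) == None)) -> open_block h -> open_block h'.
Proof. by move=> hh' /forallP oh; apply/forallP => k; rewrite hh'. Qed.

Lemma closed_block_perm (s : {perm 'I_m}) h h' :
  (forall k, (h' k == None) = (h (s k) == None)) -> closed_block h -> closed_block h'.
Proof.
move=> hh' /one_markedP[j hj Hj]; apply/one_markedP; exists (s^-1 j)%g.
  by rewrite /= hh' permKV.
move=> k kj; rewrite /= hh'; apply: Hj.
by apply: contra kj => /eqP <-; rewrite permK.
Qed.

(** Moving the leaf [j] to its other hub leaves the double vertices unchanged. *)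
Lemma leq_card_side (i : 'I_L) (j : 'I_m) (s : bool) :
  (#|[pred c : config n m | tree_code c && (c.1 i j == Some s)]| <=
   #|[pred c : config n m | tree_code c && (c.1 i j == Some (~~ s))]|)%N.
Proof.
pose psi h : block m := [ffun k => if k == j then omap negb (h k) else h k].
have psi_none h k : (psi h k == None) = (h ((1 : {perm 'I_m})%g k) == None).
  by rewrite ffunE perm1; case: ifP => // _; case: (h k).
apply: (leq_card_tree_block i (psi := psi)
  (P := fun h => h j == Some s) (Q := fun h => h j == Some (~~ s))).
- move=> h h' /ffunP E; apply/ffunP => k; have := E k; rewrite !ffunE.
  by case: ifP => // _; case: (h k) (h' k) => [[]|] [[]|].
- by move=> h; apply: open_block_perm (psi_none h).
- by move=> h; apply: closed_block_perm (psi_none h).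
- by move=> h /eqP hj; rewrite ffunE eqxx hj.
Qed.

(** By transpositions, no middle vertex of the block is double more often than another, and a tree
    has at most one double vertex per block. *)
Lemma leq_card_double (i : 'I_L) (j : 'I_m) :
  (m * #|[pred c : config n m | tree_code c && (c.1 i j == None)]| <=
   #|tree_code (n := n) (m := m)|)%N.
Proof.
have le_j k : (#|[pred c : config n m | tree_code c && (c.1 i j == None)]| <=
               #|[pred c : config n m | tree_code c && (c.1 i k == None)]|)%N.
  pose psi h : block m := [ffun l => h (tperm j k l)].
  have psi_none h l : (psi h l == None) = (h (tperm j k l) == None) by rewrite ffunE.
  apply: (leq_card_tree_block i (psi := psi)
    (P := fun h => h j == None) (Q := fun h => h k == None)).
  - move=> h h' /ffunP E; apply/ffunP => l; have := E (tperm j k l).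
    by rewrite !ffunE tpermK.
  - by move=> h; apply: open_block_perm (psi_none h).
  - by move=> h; apply: closed_block_perm (psi_none h).
  - by move=> h /eqP hj; rewrite ffunE tpermR hj.
apply: (@leq_trans (\sum_(k < m)
    #|[pred c : config n m | tree_code c && (c.1 i k == None)]|)%N).
  by rewrite -[X in (X * _)%N](card_ord m) -sum_nat_const; apply: leq_sum.
under eq_bigr do rewrite -sum1_card big_mkcond /=.
(* After exchanging the sums, each tree code must contribute at most 1. *)
rewrite exchange_big -sum1_card [leqRHS]big_mkcond; apply: leq_sum => c _.
rewrite -[c \in _]/(tree_code c); under eq_bigr do rewrite inE /=.
case: ifP => [Tc|/negbT/negbTE nTc]; last first.
  by rewrite big1 // => k _; rewrite ifN // -[c \in _]/(tree_code c) nTc.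
have [/existsP[k /eqP ck]|/existsPn nc] := boolP [exists k, c.1 i k == None]; last first.
  by rewrite big1 // => k _; rewrite (negbTE (nc k)) andbF.
rewrite (bigD1 k) //= big1 ?addn0 => [|l lk]; first by case: ifP.
rewrite ifN //; apply/negP => /eqP cl.
have [i0 _ /(_ i)] := tree_codeP _ Tc; case: ifP => _.
  by move/forallP/(_ k); rewrite ck.
case/one_markedP=> k0 _ Hk0; have [E|/Hk0] := eqVneq k k0; last by rewrite /= ck.
by have := Hk0 l; rewrite -E lk /= cl => /(_ isT).
Qed.

(** With [T] trees in all, [N (Some s) <= N (Some (~~ s))] gives
    [2 (N None + N (Some s)) <= N None + T]; multiply by [m] and use [m * N None <= T]. *)
Lemma leq_card_tree_mid (i : 'I_L) (j : 'I_m) (s : bool) :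
  (2 * m * #|[pred c : config n m | tree_code c && present c (Some (i, j, s))]| <=
   m.+1 * #|tree_code (n := n) (m := m)|)%N.
Proof.
pose N o := #|[pred c : config n m | tree_code c && (c.1 i j == o)]|.
have cardE (P : pred (config n m)) : #|P| = (\sum_c P c)%N.
  by rewrite -sum1_card big_mkcond; apply: eq_bigr => c _; rewrite /in_mem /=; case: (P c).
have defT : #|tree_code (n := n) (m := m)| = (N None + N (Some s) + N (Some (~~ s)))%N.
  rewrite /N !cardE -!big_split /=; apply: eq_bigr => c _.
  by case: (tree_code c) => //=; case: (c.1 i j) => [[]|]; case: (s).
have -> : #|[pred c : config n m | tree_code c && present c (Some (i, j, s))]| =
          (N None + N (Some s))%N.
  rewrite /N !cardE -!big_split /=; apply: eq_bigr => c _.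
  by case: (tree_code c) => //=; case: (c.1 i j) => [[]|]; case: (s).
have := leq_card_double i j; have := leq_card_side i j s; rewrite -/(N _) -/(N _).
by rewrite defT -/(N None); nia.
Qed.

End Counting.

(** * A straight-line drawing *)

Section Planarity.
Variables (R : realType) (n m : nat).
Local Notation L := n.+1.
Implicit Types (x y : edge_index n m) (v : vtx n m) (a b : R * R) (s t : R).

Definition segment a b t : R * R := (a.1 + t * (b.1 - a.1), a.2 + t * (b.2 - a.2)).

Lemma segment0 a b : segment a b 0 = a.
Proof. by rewrite /segment !mul0r !addr0 -surjective_pairing. Qed.

Lemma segment1 a b : segment a b 1 = b.
Proof. by rewrite /segment !mul1r !subrKC -surjective_pairing. Qed.

Lemma segment_inj a b : a != b -> injective (segment a b).
Proof.
move=> ab s t [/addrI Ex /addrI Ey].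
have [E1|ne1] := eqVneq b.1 a.1; last by apply: mulIf Ex; rewrite subr_eq0.
apply: mulIf Ey; rewrite subr_eq0; apply: contra ab => /eqP E2.
by rewrite [a]surjective_pairing [b]surjective_pairing E1 E2.
Qed.

Lemma continuous_segment a b : continuous (segment a b).
Proof.
have affine (c d : R) : continuous (fun t => c + t * d).
  move=> t; apply: cvgD; first exact: cvg_cst.
  by apply: cvgM; [exact: cvg_id|exact: cvg_cst].
move=> t; exact: cvg_pair (affine _ _ t) (affine _ _ t).
Qed.

(** This reads off an abscissa which half-strip a point lies in, and where. *)
Lemma natr_frac_eq (k l : nat) s t : 0 <= s < 1 -> 0 <= t < 1 ->
  k%:R + s = l%:R + t -> k = l /\ s = t.
Proof.
move=> s01 t01 E; have Ekl : k = l.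
  wlog le_kl : k l s t s01 t01 E / (k <= l)%N.
    move=> W; case/orP: (leq_total k l) => [|le_lk]; first exact: (W k l s t).
    by apply/esym/(W l k t s).
  apply/eqP; rewrite eqn_leq le_kl leqNgt; apply/negP.
  by rewrite -(ler_nat R) -natr1; lra.
by split=> //; move: E; rewrite Ekl => /addrI.
Qed.

(** The end hubs lie on the x-axis, along which the closing edge runs; the inner hubs are raised off
    it. *)
Definition hub_height (k : nat) : R := (0 < k < L)%N%:R.

(* All hubs lie below the middle vertices and, except for the two ends of the
   closing edge, above the x-axis; block [i] occupies the strip
   2 i <= x <= 2 i + 2, in which straight edges to each side fan out from a hub. *)
Definition place v : R * R :=
  match v with
  | inl k => ((2 * k)%:R, hub_height k)
  | inr (i, j) => ((2 * i + 1)%:R, (j.+2)%:R)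
  end.

(** Arcs are indexed by vertex sets, so the edge index is recovered first; the value off the edges
    is arbitrary. *)
Definition draw (e : {set vtx n m}) : R -> R * R :=
  if [pick x | edge x == e] is Some x
  then segment (place (ends x).1) (place (ends x).2) else fun=> 0.

Lemma drawE x : draw (edge x) = segment (place (ends x).1) (place (ends x).2).
Proof.
rewrite /draw; case: pickP => [y /eqP/edge_inj->//|/(_ x)].
by rewrite eqxx.
Qed.

Lemma place_inj : injective place.
Proof.
move=> [k|[i j]] [l|[i' j']] [/eqP + /eqP]; rewrite eqr_nat.
- by move=> /eqP E _; congr inl; apply: val_inj => /=; lia.
- by move=> /eqP E; lia.
- by move=> /eqP E; lia.
rewrite !eqr_nat => /eqP E /eqP E'.
have <- : i = i' by apply: val_inj => /=; lia.
by have <- : j = j' by apply: val_inj => /=; lia.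
Qed.

Lemma hub_height01 (k : nat) : 0 <= hub_height k <= 1.
Proof. by rewrite /hub_height; case: (0 < k < L)%N; rewrite lexx ler01. Qed.

Lemma place_side (i : 'I_L) (s : bool) :
  place (hub n m (i + s)) = ((2 * (i + s))%:R, hub_height (i + s)).
Proof. by rewrite /= inordK ?ltnS ?side_le. Qed.

(** Segments start at the hub, so those on the right side run leftwards; this is the offset from the
    left border of the half-strip. *)
Definition side_param (s : bool) t : R := if s then 1 - t else t.

Lemma side_param01 (s : bool) t : 0 < t < 1 -> 0 < side_param s t < 1.
Proof. by rewrite /side_param; case: s; lra. Qed.

Lemma draw_mid (i : 'I_L) (j : 'I_m) (s : bool) t :
  draw (edge (Some (i, j, s))) t =
  ((2 * i + s)%:R + side_param s t,
   hub_height (i + s) + t * (j.+2%:R - hub_height (i + s))).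
Proof.
rewrite drawE [(ends _).1]/= place_side /segment /=; congr (_, _).
by rewrite /side_param; case: s => /=; rewrite !natrM !natrD; ring.
Qed.

Lemma draw_mid_gt0 (i : 'I_L) (j : 'I_m) (s : bool) t : 0 < t < 1 ->
  0 < (draw (edge (Some (i, j, s))) t).2.
Proof.
move=> /andP[t0 t1]; rewrite draw_mid /=.
have /andP[h0 h1] := hub_height01 (i + s); move: (hub_height _) h0 h1 => h h0 h1.
have : 0 < t * j.+2%:R by rewrite mulr_gt0 // ltr0n.
have : 0 <= (1 - t) * h by rewrite mulr_ge0 // subr_ge0 ltW.
by nra.
Qed.

Lemma draw_closing t :
  draw (edge (None : edge_index n m)) t = (t * (2 * L)%:R, 0).
Proof.
rewrite drawE /segment /= /hub_height ltnn ltnn /= muln0.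
by rewrite !(subr0, add0r) mulr0.
Qed.

Lemma planar_chain : planar R (chain n m).
Proof.
exists place, draw; split; first exact: place_inj.
- move=> _ /imsetP[x _ ->]; rewrite drawE; split.
  + exact/continuous_subspaceT/continuous_segment.
  + apply: in2W; apply: segment_inj; apply/eqP => /place_inj.
    by case: x => [[[i j] s]|] //= [].
  + rewrite segment0 segment1; apply/seteqP; split=> z.
      by case=> ->; [exists (ends x).1|exists (ends x).2]; rewrite //= !inE eqxx ?orbT.
    by case=> v /=; rewrite !inE => /orP[]/eqP-> <-; [left|right].
- move=> _ v t /imsetP[x _ ->]; rewrite in_itv /= => t01.
  case: x => [[[i j] s]|]; last first.
    rewrite draw_closing; case: v => [k|[i j]] /= [+ /eqP]; last first.
      by move=> _; rewrite eq_sym pnatr_eq0.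
    (* Only the end hubs have height 0, and the closing edge meets them only at its ends. *)
    rewrite /hub_height eq_sym pnatr_eq0 eqb0 negb_and -!leqNgt leqn0.
    case/andP: t01 => t0 t1 E /orP[/eqP k0|le_k].
      by have := mulr_gt0 t0 (ltr0Sn R (2 * L).-1); rewrite E k0 muln0 ltxx.
    have kL : (k : nat) = L by have := ltn_ord k; lia.
    move: E; rewrite kL; have := ltr0Sn R (2 * L).-1; rewrite prednK //; nra.
  (* Interior points of these edges have non-integral abscissas, vertices integral ones. *)
  rewrite draw_mid; have /andP[u0 u1] := side_param01 s t01.
  have u01 : 0 <= side_param s t < 1 by rewrite ltW.
  have z01 : 0 <= (0 : R) < 1 by rewrite lexx ltr01.
  case: v => [k|[i' j']] /= [+ _]; rewrite -[RHS]addr0.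
    by move=> /(natr_frac_eq u01 z01)[_ E]; rewrite E ltxx in u0.
  by move=> /(natr_frac_eq u01 z01)[_ E]; rewrite E ltxx in u0.
move=> _ _ s t /imsetP[x _ ->] /imsetP[y _ ->] xy.
rewrite !in_itv /= => s01 t01.
case: x y xy => [[[i j] b]|] [[[i' j'] b']|] //; last by rewrite eqxx.
(* Equal abscissas force the same half-strip, hence the same hub and parameter; equal heights then
   force the same middle vertex. *)
- rewrite !draw_mid => ne [] .
  have /andP[u0 u1] := side_param01 b s01; have /andP[u0' u1'] := side_param01 b' t01.
  move=> /natr_frac_eq[] //; rewrite ?(ltW u0) ?(ltW u0') // => E.
  have bb' : b = b' by case: b b' E {ne u0 u1 u0' u1'} => [] [] //=; lia.
  have ii' : i = i' by apply: val_inj => /=; rewrite bb' in E; lia.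
  rewrite -bb' -ii' in ne *; rewrite /side_param => Est.
  have {Est} st : s = t by case: (b) Est; lra.
  rewrite -st => /addrI/mulfI -/(_ (lt0r_neq0 (proj1 (andP s01))))/addIr/eqP.
  rewrite eqr_nat => /eqP Ej; case/eqP: ne; congr (edge (Some (_, _, _))).
  by apply: val_inj => /=; lia.
- by move=> _ E; have := draw_mid_gt0 i j b s01; rewrite E draw_closing ltxx.
- by move=> _ E; have := draw_mid_gt0 i' j' b' t01; rewrite -E draw_closing ltxx.
Qed.

End Planarity.

(** * Edge densities and the choice of parameters *)

Section Densities.
Variables n m : nat.
Local Notation L := n.+1.

Lemma tau_chain_gt0 : (0 < m)%N -> (0 < tau (chain n m))%N.
Proof.
move=> m_gt0; rewrite tau_chain card_tree card_tree_with card_tree_without.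
by rewrite ltn_addl // expn_gt0 muln_gt0 m_gt0 expn_gt0.
Qed.

(** With [a = 2 ^ m.-1] and [A = (m * a) ^ n], there are [2 L a A] trees with the closing edge and
    [m a A] without. *)
Lemma density_closing : (0 < m)%N ->
  @density (chain n m) (edge None) = (2 * L)%:R / (2 * L + m)%:R.
Proof.
move=> m_gt0; have tau_gt0 := tau_chain_gt0 m_gt0.
apply/eqP; rewrite /density eqr_div ?pnatr_eq0; [|lia|lia].
rewrite -!natrM eqr_nat tau_edge_chain tau_chain card_tree.
have E2 : (2 ^ m = 2 * 2 ^ m.-1)%N by rewrite -expnS prednK.
rewrite card_tree_with card_tree_without [(_ ^ L)%N]expnS E2.
by move: (2 ^ m.-1)%N (_ ^ n)%N => a A; apply/eqP; lia.
Qed.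

Lemma density_mid_le (i : 'I_L) (j : 'I_m) (s : bool) :
  @density (chain n m) (edge (Some (i, j, s))) <= m.+1%:R / (2 * m)%:R.
Proof.
have m_gt0 : (0 < m)%N by exact: leq_ltn_trans (ltn_ord j).
rewrite /density ler_pdivrMr ?ltr0n ?tau_chain_gt0 // mulrAC.
rewrite ler_pdivlMr ?ltr0n ?muln_gt0 // -!natrM ler_nat mulnC.
by rewrite tau_edge_chain tau_chain leq_card_tree_mid.
Qed.

End Densities.

Theorem corollary3p11 (R : realType) (p q : nat) (hp : (0 < p)%N)
    (hq : (0 < q)%N) (hlo : (1 / 2 : rat) < p%:R / q%:R)
    (hhi : (p%:R / q%:R : rat) < 1) :
  exists G : sgraph,
    [/\ connected_graph G, planar R G & dep G = p%:R / q%:R].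
Proof.
have lt_pq : (p < q)%N by move: hhi; rewrite ltr_pdivrMr ?ltr0n // mul1r ltr_nat.
have lt_q2p : (q < 2 * p)%N.
  move: hlo; rewrite ltr_pdivlMr ?ltr0n // mulrAC ltr_pdivrMr // mul1r.
  by rewrite -natrM ltr_nat mulnC.
pose n := (p * q).-1; pose m := (2 * (q - p) * q)%N.
have defL : n.+1 = (p * q)%N by rewrite prednK // muln_gt0 hp.
have m_gt0 : (0 < m)%N by rewrite !muln_gt0 subn_gt0 lt_pq.
have densE : @density (chain n m) (edge None) = p%:R / q%:R.
  (* The value is [2 p q / (2 p q + 2 (q - p) q)]. *)
  rewrite density_closing // defL; apply/eqP.
  rewrite eqr_div ?pnatr_eq0; [|lia|lia].
  by rewrite -!natrM eqr_nat /m; apply/eqP; nia.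
exists (chain n m); split; last 1 first.
- apply/le_anti/andP; split; last first.
    by rewrite -densE; apply: le_bigmax_cond; apply: imset_f; rewrite inE.
  apply: bigmax_le => [|e /imsetP[x _ ->]]; first by rewrite divr_ge0.
  case: x => [[[i j] s]|]; last by rewrite densE.
  (* The bound is at most [p / q] when [q <= m (2 p - q)], which holds since [2 p - q >= 1] and
     [m >= 2 q]. *)
  apply: le_trans (density_mid_le i j s) _.
  rewrite ler_pdivrMr ?ltr0n; last by lia.
  by rewrite mulrAC ler_pdivlMr ?ltr0n // -!natrM ler_nat /m; nia.
(* The graph is connected because it contains a spanning tree. *)
- have /card_gt0P[c Tc] : (0 < #|tree_code (n := n) (m := m)|)%N.
    by rewrite -tau_chain tau_chain_gt0.
  have [/fintype.subsetP subF [V_gt0 conF] _] := tree_code_tree Tc.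
  split=> // u v; apply: connect_sub (conF u v) => a b ab.
  by apply: connect1; exact: subF.
- exact: planar_chain.
Qed.
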